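(* If a weighted graph $G(V,E,w)$ is strictly $2$-convex, then the graph $G(V,E)$ is a tree.
   Context: All graphs are finite, simple and connected. A weighted graph $G(V,E,w)$ is a graph with vertex set $V$ and edge set $E$ together with a weight function $w:V\to\mathbb{R}_+$, where $\mathbb{R}_+=[0,\infty)$. $G(V,E,w)$ is called strictly $2$-convex if for every vertex $v\in V$ having at least two adjacent vertices, and for every two distinct vertices $v_1,v_2$ adjacent to $v$, one has $2w(v)<w(v_1)+w(v_2)$. *)

(* Defs.v *)
From mathcomp Require Import all_boot all_order all_algebra.
From mathcomp Require Import reals.

Set Implicit Arguments.
Unset Strict Implicit.
Unset Printing Implicit Defensive.

Import Order.TTheory GRing.Theory Num.Theory.
Local Open Scope ring_scope.

(* A graph on the finite vertex type V is given by its adjacency relation e. *)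
Definition simple_graph (V : finType) (e : rel V) : Prop :=
  symmetric e /\ irreflexive e.

(* The empty graph is not counted as connected, hence not as a tree. *)
Definition connected_graph (V : finType) (e : rel V) : Prop :=
  (0 < #|V|)%N /\ forall x y : V, connect e x y.

(* ucycle e c only says that the vertices of c are distinct and cyclically
   adjacent: it also holds of [::] and, for symmetric e, of the back-and-forth
   walk [:: x; y] along an edge, so cycles need length at least 3. *)
Definition acyclic_graph (V : finType) (e : rel V) : Prop :=
  forall c : seq V, (3 <= size c)%N -> ~ ucycle e c.

Definition is_tree (V : finType) (e : rel V) : Prop :=
  [/\ simple_graph e, connected_graph e & acyclic_graph e].

Definition neighbours (V : finType) (e : rel V) (v : V) : {set V} :=
  [set u | e v u].

Definition strictly_2convex (R : realType) (V : finType) (e : rel V)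
    (w : V -> R) : Prop :=
  forall v : V, (2 <= #|neighbours e v|)%N ->
  forall v1 v2 : V, v1 \in neighbours e v -> v2 \in neighbours e v ->
    v1 != v2 -> 2 * w v < w v1 + w v2.

(* Main.v *)
Require Import Defs.
From mathcomp Require Import all_boot all_order all_algebra.
From mathcomp Require Import reals.

(** Connectedness is assumed, so only acyclicity is at stake.  On a cycle, which
    is finite, the weight attains its maximum at some vertex [v].  A cycle of
    length at least 3 gives [v] two distinct neighbours on it, neither of larger
    weight, so their weights sum to at most [2 * w v]: this is exactly what
    strict 2-convexity at [v] forbids. *)

Import Order.TTheory GRing.Theory Num.Theory.
Local Open Scope ring_scope.

(** Rotating the cycle so that it starts at [v] exhibits the two neighbours as
    its second and last entries; these are different positions because the
    length is at least 3, hence different vertices because entries are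
    distinct. *)
Lemma ucycle_two_neighbours (V : finType) (e : rel V) (c : seq V) (v : V) :
  symmetric e -> (3 <= size c)%N -> ucycle e c -> v \in c ->
  exists v1 v2 : V,
    [/\ v1 \in c, v2 \in c, e v v1, e v v2 & v1 != v2].
Proof.
move=> e_sym c_size c_cyc v_c.
have [i s def_c] := rot_to v_c.
have mem_c u : (u \in c) = (u \in v :: s) by rewrite -def_c mem_rot.
move: c_cyc c_size; rewrite -(rot_ucycle i) -(size_rot i c) def_c.
case: s {def_c} mem_c => [|y [|z s]] // mem_c.
rewrite /ucycle /= rcons_path => /andP[/and4P[e_vy _ _ e_last]].
case/and4P=> _ y_notin _ _ _.
exists y, (last z s); split=> //.
- by rewrite mem_c !inE eqxx orbT.
- by rewrite mem_c 2!in_cons mem_last !orbT.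
- by rewrite e_sym.
- by apply: contraNneq y_notin => ->; apply: mem_last.
Qed.

Theorem proposition1p8 (R : realType) (V : finType) (e : rel V) (w : V -> R)
    (e_simple : simple_graph e) (e_connected : connected_graph e)
    (w_ge0 : forall v : V, 0 <= w v)
    (w_convex : strictly_2convex e w) :
  is_tree e.
Proof.
split=> // c c_size c_cyc.
have [e_sym _] := e_simple.
have [x x_c] : exists x, x \in c.
  by case: c c_size {c_cyc} => // x c _; exists x; rewrite mem_head.
have [v v_c v_max] := @arg_maxP _ R V x (mem c) w x_c.
have [v1 [v2 [v1_c v2_c e_v1 e_v2 v12]]] :=
  ucycle_two_neighbours _ _ _ _ e_sym c_size c_cyc v_c.
have v1_nb : v1 \in neighbours e v by rewrite inE.
have v2_nb : v2 \in neighbours e v by rewrite inE.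
have nb_ge2 : (2 <= #|neighbours e v|)%N.
  by apply/card_gt1P; exists v1, v2.
have := w_convex v nb_ge2 v1 v2 v1_nb v2_nb v12.
by rewrite mulr_natl mulr2n ltNge lerD //; apply: v_max.
Qed.
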